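(* In the Distributed PDDY Algorithm, suppose that $\gamma_k\equiv\gamma\in(0,2/L_{\widehat{F}})$ and $\eta\geq\|\widehat{K}\|^2$, where $L_{\widehat{F}}=\max_{m=1,\ldots,M}\frac{L_{F_m}}{M\omega_m}$ and $\|\widehat{K}\|^2=\max_{m=1,\ldots,M}\|K_m\|^2$ or, in the case $F_m\equiv0$ for all $m$, $\|\widehat{K}\|^2=\big\|\sum_{m=1}^M\omega_mK_m^*K_m\big\|$. Then all $x_m^k$, $m=1,\ldots,M$, as well as $x_R^k$ converge to the same minimizer $x^\star$ of $\Psi$, and every $u_m^k$ converges to some element $u_m^\star\in\mathcal{U}_m$.
   Context: Let $M\geq1$. $\mathcal{X}$ and $\mathcal{U}_1,\ldots,\mathcal{U}_M$ are finite-dimensional real Hilbert spaces; $K_m:\mathcal{X}\to\mathcal{U}_m$ are linear operators with adjoints $K_m^*$; $R:\mathcal{X}\to\mathbb{R}\cup\{+\infty\}$ and $H_m:\mathcal{U}_m\to\mathbb{R}\cup\{+\infty\}$ are proper, closed, convex; $F_m:\mathcal{X}\to\mathbb{R}$ are convex and $L_{F_m}$-smooth, $L_{F_m}>0$ (differentiable with $L_{F_m}$-Lipschitz gradient). Set $$\Psi(x)=\frac1M\sum_{m=1}^M\big(F_m(x)+H_m(K_mx)\big)+R(x).$$ $(\omega_m)_{m=1}^M$ are positive weights with $\sum_m\omega_m=1$. $G^*$ denotes the convex conjugate of $G$ and $\mathrm{prox}_G(z)=\arg\min_{z'}\{G(z')+\frac12\|z-z'\|^2\}$. Standing assumption: there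 exists $x^\star\in\mathcal{X}$ with $0\in\frac1M\sum_{m=1}^M\big(\nabla F_m(x^\star)+K_m^*\partial H_m(K_mx^\star)\big)+\partial R(x^\star)$. Distributed PDDY Algorithm: given positive stepsizes $(\gamma_k)_{k\in\mathbb{N}}$, $\eta>0$, $x_R^0\in\mathcal{X}$, $u_m^0\in\mathcal{U}_m$, set $p_m^0=K_m^*u_m^0$, $m=1,\ldots,M$. For $k=0,1,\ldots$ iterate: for $m=1,\ldots,M$, $$u_m^{k+1}=\mathrm{prox}_{M\omega_mH_m^*/(\gamma_k\eta)}\Big(u_m^k+\tfrac{M\omega_m}{\gamma_k\eta}K_mx_R^k\Big),\quad p_m^{k+1}=K_m^*u_m^{k+1},$$ $$x_m^{k+1}=x_R^k-\tfrac{\gamma_k}{M\omega_m}(p_m^{k+1}-p_m^k),\quad a_m^k=M\omega_mx_m^{k+1}-\gamma_{k+1}\nabla F_m(x_m^{k+1})-\gamma_{k+1}p_m^{k+1},$$ and then $x_R^{k+1}=\mathrm{prox}_{\gamma_{k+1}R}\big(\frac1M\sum_{m=1}^Ma_m^k\big)$. *)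

(* Defs.v *)
From HB Require Import structures.
From mathcomp Require Import all_boot all_order all_algebra.
From mathcomp Require Import all_classical all_reals all_analysis.

Set Implicit Arguments.
Unset Strict Implicit.
Unset Printing Implicit Defensive.

Import Order.TTheory GRing.Theory Num.Theory.
Import numFieldNormedType.Exports.

Local Open Scope classical_set_scope.
Local Open Scope ring_scope.

(* Finite dimension comes from Vector; the topology is that of the norm, which
   the last field ties to the inner product. *)
HB.mixin Record isFinHilbert (R : realType) V
    of NormedModule R V & Vector R V := {
  dotp : {dot V for (@idfun R)};
  sqr_norm_dotp : forall x : V, `|x| ^+ 2 = dotp x x }.

#[short(type="finHilbertType")]
HB.structure Definition FinHilbert (R : realType) :=
  {V of NormedModule R V & Vector R V & isFinHilbert R V}.

Section Operators.
Context {R : realType}.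
Implicit Types X Y : finHilbertType R.

(* The default 0 is junk, never used for linear phi (rieszP). *)
Definition riesz X (phi : X -> R) : X :=
  xget 0 [set v | forall h, phi h = dotp h v].

Lemma rieszP X (phi : {scalar X}) (h : X) :
  phi h = dotp h (riesz phi).
Proof.
pose b := vbasis {:X}; pose T v := \row_(i < \dim {:X}) dotp b`_i v.
have T_lin : linear T.
  by move=> c v v'; apply/rowP => i; rewrite !mxE linearPr.
pose mT := GRing.isLinear.Build _ _ _ _ T T_lin.
pose LT : {linear _ -> _} := HB.pack T mT.
pose f : 'Hom(X, 'rV[R]_(\dim {:X})) := linfun LT.
have kf : lker f == 0%VS.
  rewrite -subv0; apply/subvP => v; rewrite memv_ker lfunE /= => /eqP/rowP Tv0.
  rewrite memv0 -normr_eq0 -sqrf_eq0 sqr_norm_dotp.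
  rewrite [X in dotp X](coord_vbasis (memvf v)) linear_sumlz.
  by rewrite big1// => i _; rewrite linearZl_LR; move: (Tv0 i); rewrite !mxE /b /= => ->; rewrite mulr0.
have /memv_imgP[v _ fv] : (\row_i phi b`_i) \in limg f.
  suff -> : limg f = fullv by rewrite memvf.
  apply/eqP; rewrite eqEdim subvf /= limg_dim_eq ?(eqP kf) ?capv0//.
  by rewrite !dimvf dim_matrix mul1r.
have vP : [set v | forall h, phi h = dotp h v] v.
  move=> /= {}h; rewrite [h](coord_vbasis (memvf h)) linear_sumlz linear_sum.
  apply: eq_bigr => i _; rewrite linearZl_LR linearZ /=; congr (_ * _).
  by move/rowP: fv => /(_ i); rewrite lfunE !mxE.
by have /= := xgetI 0 vP; exact.
Qed.

Definition adjoint X Y (K : {linear X -> Y}) (u : Y) : X :=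
  riesz (fun x => dotp (K x) u).

Definition gradient X (F : X -> R) (x : X) : X := riesz ('d F x).

Definition opnorm X Y (T : X -> Y) : R :=
  sup [set `|T x| | x in [set x | `|x| <= 1]].

Definition smooth X (L : R) (F : X -> R) : Prop :=
  (forall x : X, differentiable F x) /\
  (forall x y, `|gradient F x - gradient F y| <= L * `|x - y|).

End Operators.

Section ConvexAnalysis.
Context {R : realType} {X : finHilbertType R}.
Implicit Types (G : X -> \bar R) (x z g : X).
Local Open Scope ereal_scope.

Definition proper G : Prop :=
  (forall x, G x != -oo) /\ (exists x, G x != +oo).

(* At t = 0 and t = 1 the convention 0 * +oo = 0 of \bar R makes the inequality
   trivial, so both endpoints are harmless. *)
Definition convexe G : Prop :=
  forall (t : R) x y, (0 <= t <= 1)%R ->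
    G (t *: x + (1 - t) *: y)%R <= t%:E * G x + (1 - t)%:E * G y.

Definition proper_closed_convex G : Prop :=
  [/\ proper G, lower_semicontinuous G & convexe G].

Definition subdiff G x : set X :=
  [set g | forall y, G x + (dotp g (y - x)%R)%:E <= G y].

Definition conjugate G (z : X) : \bar R :=
  ereal_sup [set (dotp z x)%:E - G x | x in [set: X]].

Definition argmin G : set X := [set x | forall y, G x <= G y].

(* The minimiser is unique, by strong convexity, and exists for G proper, closed
   and convex; the default 0 is junk for other G. *)
Definition prox G (z : X) : X :=
  xget 0%R (argmin (fun z' => G z' + (2^-1 * `|z - z'| ^+ 2)%:E)).

End ConvexAnalysis.

Section Problem.
Context {R : realType} {X : finHilbertType R} {M : nat}.
Context {U : 'I_M -> finHilbertType R}.
Variables (K : forall m, {linear X -> U m}).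
Variables (F : 'I_M -> X -> R) (H : forall m, U m -> \bar R) (Rg : X -> \bar R).

Definition Psi (x : X) : \bar R :=
  ((M%:R^-1)%:E * (\sum_(m < M) ((F m x)%:E + H (K m x))) + Rg x)%E.

(* 0 \in 1/M sum_m (grad F_m(x) + K_m^* (subdiff H_m (K_m x))) + subdiff Rg x,
   the Minkowski sum being unfolded. *)
Definition zero_of_inclusion (x : X) : Prop :=
  exists (h : forall m, U m) (r : X),
    [/\ forall m, subdiff (@H m) (K m x) (h m), subdiff Rg x r &
        0 = M%:R^-1 *: (\sum_(m < M)
              (gradient (F m) x + adjoint (K m) (h m))) + r].

(* x m 0 is not produced by the algorithm and is left unconstrained. *)
Record distributed_PDDY (w : 'I_M -> R) (gam : nat -> R) (eta : R)
    (xR : nat -> X) (x p a : 'I_M -> nat -> X)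
    (u : forall m, nat -> U m) : Prop := {
  PDDY_p0 : forall m, p m 0%N = adjoint (K m) (u m 0%N);
  PDDY_u : forall m k, u m k.+1 =
    prox (fun v => ((M%:R * w m / (gam k * eta))%:E * conjugate (@H m) v)%E)
         (u m k + (M%:R * w m / (gam k * eta)) *: K m (xR k));
  PDDY_p : forall m k, p m k.+1 = adjoint (K m) (u m k.+1);
  PDDY_x : forall m k, x m k.+1 =
    xR k - (gam k / (M%:R * w m)) *: (p m k.+1 - p m k);
  PDDY_a : forall m k, a m k =
    (M%:R * w m) *: x m k.+1 - gam k.+1 *: gradient (F m) (x m k.+1)
    - gam k.+1 *: p m k.+1;
  PDDY_xR : forall k, xR k.+1 =
    prox (fun z => ((gam k.+1)%:E * Rg z)%E)
         (M%:R^-1 *: \sum_(m < M) a m k) }.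

End Problem.

(* Main.v *)
From HB Require Import structures.
Require Import Defs.
From mathcomp Require Import all_boot all_order all_algebra.
From mathcomp Require Import all_classical all_reals all_analysis.
From mathcomp Require Import ring lra.
Import Order.TTheory GRing.Theory Num.Theory.
Import numFieldNormedType.Exports.
Local Open Scope classical_set_scope.
Local Open Scope ring_scope.
Set Implicit Arguments.
Unset Strict Implicit.
Unset Printing Implicit Defensive.

(** Put [c m = gamma / (M w_m)] and let [(xs, us)] solve the primal-dual
    optimality system [saddle]. The iteration is a Davis-Yin splitting of that
    system, and the distance that it decreases is measured, with [d = xR - xs]
    and [v m = u m - us m], by
      [energy d v = sum_m w m (|d|^2 + 2 c_m <K m d, v m> + c_m^2 eta |v m|^2)].

    An algebraic identity ([block_energy_step]) writes the change of each block
    of the energy in one step as minus the energy of the increment, minus terms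
    that are nonnegative because the subdifferentials of [H m] and of [Rg] are
    monotone, minus the inner product of the gradient increment with the new
    [d]. Since the gradients are cocoercive ([gradient_cocoercive], Baillon and
    Haddad), this last term costs only a fraction of the energy of the increment
    when [c m] is less than twice the inverse of the Lipschitz constant of the
    gradient of [F m] ([block_energy_forward]); it is absent when the [F m]
    vanish. So the energy decreases by at least [rho > 0] times the energy of
    the increment ([energy_descent]), for every solution [(xs, us)].

    As [eta] may be equal to the squared operator norm, the energy is only a
    seminorm, and its boundedness says nothing directly about the iterates. But
    it controls the vectors [K m d + (c m * eta) *: v m] ([energy_block_le]),
    which up to a factor are the differences of the arguments of the dual
    proximal steps. These steps are nonexpansive, so the next dual iterates, and
    then the next primal iterate, are controlled by the energy
    ([dual_step_le], [primal_le_energies]). Applied to [(xs, us)] this bounds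
    the iterates; applied to consecutive iterates it makes the increments vanish.

    Hence the iterates have a cluster point along an ultrafilter, and it solves
    the optimality system because subdifferentials have closed graphs
    ([saddle_of_cluster]). The energy relative to this solution is nonincreasing
    and tends to zero along the ultrafilter, so it tends to zero, and every
    iterate converges to this solution, whose primal part minimises [Psi]
    ([saddle_argmin]).

    The proximal steps enter through their optimality conditions only. Minimisers
    exist by compactness of balls and a linear lower bound on convex functions
    ([prox_objective_min]), and Moreau's decomposition turns the proximal step of
    the conjugate into an inclusion in the subdifferential of [H m]
    ([prox_conjugate_subdiff]). *)

(** * Inner products and compactness *)

Section InnerProduct.
Context {R : realType} {X : finHilbertType R}.
Implicit Types x y z : X.

Lemma dotpC x y : dotp x y = dotp y x.
Proof. by rewrite hermC expr0 mul1r. Qed.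

Lemma dotpDr x y z : dotp x (y + z) = dotp x y + dotp x z.
Proof. by rewrite linearDr. Qed.
Lemma dotpDl x y z : dotp (y + z) x = dotp y x + dotp z x.
Proof. by rewrite !(dotpC _ x) dotpDr. Qed.
Lemma dotpNr x y : dotp x (- y) = - dotp x y.
Proof. by rewrite linearNr. Qed.
Lemma dotpNl x y : dotp (- y) x = - dotp y x.
Proof. by rewrite !(dotpC _ x) dotpNr. Qed.
Lemma dotpZr (t : R) x y : dotp x (t *: y) = t * dotp x y.
Proof. by rewrite linearZr_LR. Qed.
Lemma dotpZl (t : R) x y : dotp (t *: y) x = t * dotp y x.
Proof. by rewrite !(dotpC _ x) dotpZr. Qed.
Lemma dotp0r x : dotp x 0 = 0.
Proof. by rewrite linear0r. Qed.
Lemma dotp0l x : dotp 0 x = 0.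
Proof. by rewrite dotpC dotp0r. Qed.

Definition dotpE := (dotpDr, dotpDl, dotpNr, dotpNl, dotpZr, dotpZl).

Lemma dotp_sumr (I : Type) (r : seq I) (f : I -> X) x :
  dotp x (\sum_(i <- r) f i) = \sum_(i <- r) dotp x (f i).
Proof. by rewrite linear_sum. Qed.

Lemma dotp_suml (I : Type) (r : seq I) (f : I -> X) x :
  dotp (\sum_(i <- r) f i) x = \sum_(i <- r) dotp (f i) x.
Proof. by rewrite dotpC dotp_sumr; apply: eq_bigr => i _; rewrite dotpC. Qed.

Lemma dotp_ext x y : (forall h, dotp h x = dotp h y) -> x = y.
Proof.
move=> e; apply/eqP; rewrite -subr_eq0 -normr_eq0 -sqrf_eq0 sqr_norm_dotp.
by rewrite dotpDr dotpNr e subrr.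
Qed.

Lemma dotp_le_norm x y : dotp x y <= `|x| * `|y|.
Proof.
have [->|x0] := eqVneq x 0; first by rewrite dotp0l normr0 mul0r.
have [->|y0] := eqVneq y 0; first by rewrite dotp0r normr0 mulr0.
have xy0 : 0 < `|x| * `|y| by rewrite mulr_gt0 ?normr_gt0.
have := sqr_ge0 `| `|y| *: x - `|x| *: y|.
rewrite sqr_norm_dotp !dotpE -!sqr_norm_dotp (dotpC y x) => h.
rewrite -(ler_pM2l xy0); nra.
Qed.

Lemma normr_dotp x y : `|dotp x y| <= `|x| * `|y|.
Proof.
by rewrite ler_norml dotp_le_norm andbT lerNl -dotpNl -(normrN x) dotp_le_norm.
Qed.

(** Young's inequality, with the weight that makes it optimal left free. *)
Lemma dotp_young (t : R) x y : 0 < t ->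
  2 * dotp x y <= t * `|x| ^+ 2 + t^-1 * `|y| ^+ 2.
Proof.
move=> t0; have := sqr_ge0 `|t *: x - y|.
rewrite sqr_norm_dotp !dotpE -!sqr_norm_dotp (dotpC y x) => h.
rewrite -(ler_pM2l t0) mulrDr [X in _ <= _ + X]mulrA mulfV ?gt_eqF// mul1r; nra.
Qed.

Lemma sqr_normB x y : `|x - y| ^+ 2 = `|x| ^+ 2 - 2 * dotp x y + `|y| ^+ 2.
Proof. rewrite !sqr_norm_dotp !dotpE (dotpC y x); ring. Qed.

Lemma sqr_normD x y : `|x + y| ^+ 2 = `|x| ^+ 2 + 2 * dotp x y + `|y| ^+ 2.
Proof. rewrite !sqr_norm_dotp !dotpE (dotpC y x); ring. Qed.

Lemma cvg_dotp (T : Type) (FF : set_system T) {FFF : Filter FF} (f g : T -> X) a b :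
  f @ FF --> a -> g @ FF --> b -> (fun t => dotp (f t) (g t)) @ FF --> dotp a b.
Proof.
move=> fa gb.
(* polarisation reduces the claim to the continuity of the norm *)
have pol x y : dotp x y = 2^-1 * (`|x + y| * `|x + y| - `|x| * `|x| - `|y| * `|y|).
  by rewrite -!expr2 sqr_normD; field.
rewrite pol; under eq_fun do rewrite pol.
apply: cvgM; first exact: cvg_cst.
have nfg : (fun t => `|f t + g t|) @ FF --> `|a + b|.
  by apply: cvg_norm; exact: cvgD.
have nf : (fun t => `|f t|) @ FF --> `|a| by exact: cvg_norm.
have ng : (fun t => `|g t|) @ FF --> `|b| by exact: cvg_norm.
by apply: cvgB; [apply: cvgB|]; exact: cvgM.
Qed.

Lemma cvg_sqr_norm0 (T : Type) (FF : set_system T) {FFF : Filter FF} (f : T -> X) :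
  (fun t => `|f t| ^+ 2) @ FF --> (0 : R) -> f @ FF --> 0.
Proof.
move=> f0; apply/cvgr0Pnorm_lt => e e0.
have e20 : 0 < e ^+ 2 by rewrite exprn_gt0.
move/cvgr0Pnorm_lt/(_ _ e20) : f0; apply: filterS => t.
by rewrite ger0_norm ?exprn_ge0// ltr_pXn2r// ?nnegrE// ltW.
Qed.

Let n := \dim {:X}.
Let b := vbasis {:X}.

(** Coordinates transport the statement to row vectors: the synthesis map is
    continuous there, and the coordinate map is bounded because each coordinate
    is an inner product. *)
Lemma ball_compact (r : R) : compact [set x : X | `|x| <= r].
Proof.
pose sc i : {scalar X} := coord b i.
pose syn (c : 'rV[R]_n) : X := \sum_(i < n) c ord0 i *: b`_i.
have syn_cts : continuous syn.
  move=> c; apply: (@cvg_big _ _ _ _ _ _ _ (nbhs c)) => [|i _].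
    exact: add_continuous.
  by apply: cvgZ; [exact: coord_continuous|exact: cvg_cst].
pose A := [set c | `|syn c| <= r].
have -> : [set x : X | `|x| <= r] = syn @` A.
  rewrite eqEsubset; split=> [x /= xr|_ [c /= cA <-]//].
  exists (\row_i sc i x); rewrite /A /= /syn; under eq_bigr do rewrite mxE.
    by rewrite -coord_vbasis// memvf.
  by rewrite -coord_vbasis// memvf.
apply: continuous_compact; first exact/continuous_subspaceT.
apply: bounded_closed_compact; last first.
  have -> : A = (fun c => `|syn c|) @^-1` [set t | t <= r] by [].
  apply: closed_comp; last exact: closed_le.
  move=> c _; apply: (@continuous_comp _ _ _ syn (fun y : X => `|y|)).
    exact: syn_cts.
  exact: norm_continuous.
(* the coordinates are the inner products with the Riesz vectors of [coord b] *)
pose C := \sum_(i < n) `|r| * `|riesz (sc i)|.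
exists C; split; first by rewrite num_real.
move=> s Cs c /= cr; rewrite [leLHS]/Num.Def.normr /= mx_normrE.
apply: bigmax_le => [|[i j] _ /=].
  by apply: ltW; apply: le_lt_trans Cs; apply: sumr_ge0 => i _; rewrite mulr_ge0.
apply: ltW; apply: le_lt_trans Cs; rewrite (ord1 i).
have -> : c ord0 j = sc j (syn c).
  by symmetry; apply: coord_sum_free; exact: basis_free (vbasisP _).
rewrite rieszP /C (bigD1 j)//=; apply: ler_wpDr.
  by apply: sumr_ge0 => k _; rewrite mulr_ge0.
apply: le_trans (normr_dotp _ _) _; apply: ler_wpM2r => //.
exact: le_trans cr (ler_norm _).
Qed.

(** An ultrafilter finer than the index filter replaces the extraction of a
    subsequence: one choice makes any number of bounded sequences converge. *)
Lemma bounded_ultra_cvg (T : Type) (UF : set_system T) {UFF : UltraFilter UF}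
    (s : T -> X) (r : R) :
  (\forall t \near UF, `|s t| <= r) -> exists l : X, s @ UF --> l.
Proof.
move=> sr; have [l [_ ls]] := @ball_compact r _ (fmap_proper_filter s _) sr.
exists l => N Nl /=.
have [//|sN] := in_ultra_setVsetC (s @^-1` N) UFF.
by have [y []] := ls (~` N) N sN Nl.
Qed.

End InnerProduct.

(* a vector identity is tested against an arbitrary vector *)
Ltac vect := by apply: dotp_ext => ?; rewrite !dotpE; ring.

(** * Linear operators and their adjoints *)

Section Operators.
Context {R : realType} {X Y : finHilbertType R}.
Implicit Types K : {linear X -> Y}.

Lemma dotp_adjoint K x u : dotp x (adjoint K u) = dotp (K x) u.
Proof.
pose f x := dotp (K x) u.
have fl : linear f.
  by move=> t a b; rewrite /f linearP dotpDl dotpZl.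
pose lf : {scalar X} := HB.pack f (GRing.isLinear.Build _ _ _ _ f fl).
by rewrite /adjoint -(rieszP lf).
Qed.

Lemma dotp_adjointl K x u : dotp (adjoint K u) x = dotp u (K x).
Proof. by rewrite dotpC dotp_adjoint dotpC. Qed.

Lemma adjoint_is_linear K : linear (adjoint K).
Proof.
by move=> t u v; apply: dotp_ext => h; rewrite !(dotp_adjoint, dotpE).
Qed.

Lemma adjointB K u v : adjoint K (u - v) = adjoint K u - adjoint K v.
Proof.
by rewrite addrC -scaleN1r adjoint_is_linear scaleN1r addrC.
Qed.

Lemma adjoint0 K : adjoint K 0 = 0.
Proof. by rewrite -(subrr 0) adjointB subrr. Qed.

Lemma linear_bounded K : exists2 C, 0 <= C & forall x, `|K x| <= C * `|x|.
Proof.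
pose b := vbasis {:X}; pose n := \dim {:X}.
pose sc i : {scalar X} := coord b i.
exists (\sum_(i < n) `|riesz (sc i)| * `|K b`_i|).
  by apply: sumr_ge0 => i _; rewrite mulr_ge0.
move=> x; rewrite {1}(coord_vbasis (memvf x)) linear_sum.
apply: le_trans (ler_norm_sum _ _ _) _; rewrite mulr_suml; apply: ler_sum => i _.
rewrite linearZ normrZ mulrAC; apply: ler_wpM2r => //.
by rewrite -/(sc i x) rieszP mulrC; exact: normr_dotp.
Qed.

Lemma linear_cvg K (T : Type) (FF : set_system T) {FFF : Filter FF}
    (f : T -> X) (a : X) : f @ FF --> a -> (fun t => K (f t)) @ FF --> K a.
Proof.
have [C C0 KC] := linear_bounded K; move=> fa.
apply/cvgrPdist_lt => e e0; have C1 : 0 < C + 1 by rewrite ltr_wpDl.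
have : 0 < e / (C + 1) by rewrite divr_gt0.
move/cvgrPdist_lt : fa => /[apply]; apply: filterS => t.
rewrite ltr_pdivlMr// mulrC -linearB; apply: le_lt_trans.
by apply: le_trans (KC _) _; rewrite ler_wpM2r// lerDl.
Qed.

Lemma opnorm_bound K x : `|K x| <= opnorm K * `|x|.
Proof.
have [->|x0] := eqVneq x 0; first by rewrite linear0 !normr0 mulr0.
have nx : 0 < `|x| by rewrite normr_gt0.
have [C C0 KC] := linear_bounded K.
rewrite -ler_pdivrMr//; apply: ub_le_sup.
  exists C => _ [y /= y1 <-]; apply: le_trans (KC y) _.
  by rewrite -[leRHS]mulr1 ler_wpM2l.
exists (`|x|^-1 *: x).
  by rewrite /= normrZ normfV normr_id mulVf ?gt_eqF.
by rewrite linearZ normrZ normfV normr_id mulrC.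
Qed.

End Operators.

Lemma adjoint_cvg (R : realType) (X Y : finHilbertType R) (K : {linear X -> Y})
    (T : Type) (FF : set_system T) {FFF : Filter FF} (f : T -> Y) (l : Y) :
  f @ FF --> l -> (fun t => adjoint K (f t)) @ FF --> adjoint K l.
Proof.
pose lK : {linear Y -> X} :=
  HB.pack (adjoint K) (GRing.isLinear.Build _ _ _ _ _ (adjoint_is_linear K)).
exact: (linear_cvg (K := lK)).
Qed.

(** * Convex functions, subdifferentials and proximal steps *)

Section LowerSemicontinuity.
Context {R : realType}.
Local Open Scope ereal_scope.

Lemma lsc_near (T : topologicalType) (G : T -> \bar R) (b : \bar R) x :
  lower_semicontinuous G -> b < G x -> \forall z \near x, b < G z.
Proof.
move=> Glsc; case: b => [b||] bG.
- by have [V xV VG] := Glsc _ _ bG; apply: filterS xV.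
- by move: bG; rewrite ltNge leey.
- have [a aG] : exists a : R, a%:E < G x.
    case: (G x) bG => [g||//] _; last by exists 0%R; rewrite ltry.
    by exists (g - 1)%R; rewrite lte_fin ltrBlDr ltrDl.
  have [V xV VG] := Glsc _ _ aG; apply: filterS xV => z /VG.
  by apply: lt_trans; rewrite ltNyr.
Qed.

(** The sublevel sets of [G] in [A] form a proper filter; lower semicontinuity
    makes any of its cluster points a minimiser. *)
Lemma lsc_compact_min (T : topologicalType) (G : T -> \bar R) (A : set T) :
  lower_semicontinuous G -> compact A -> A !=set0 ->
  exists2 x, A x & forall y, A y -> G x <= G y.
Proof.
move=> Glsc Aco [a Aa].
pose FF := filter_from A (fun y => A `&` [set z | G z <= G y]).
have FFp : ProperFilter FF.
  apply: filter_from_proper; last by move=> y Ay; exists y; split => /=.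
  apply: filter_from_filter; first by exists a.
  move=> i j Ai Aj; have [ij|ji] := leP (G i) (G j).
    by exists i => // z [Az /= zi]; do 2!split => //=; exact: le_trans zi ij.
  by exists j => // z [Az /= zj]; do 2!split => //=; apply: le_trans zj (ltW ji).
have [x [Ax cx]] : A `&` cluster FF !=set0.
  by apply: Aco; exists a => // z [].
exists x => // y Ay; rewrite leNgt; apply/negP => yx.
have FFy : FF (A `&` [set z | G z <= G y]) by exists y.
have [z [[_ /= zy]]] := cx _ _ FFy (lsc_near Glsc yx).
by rewrite ltNge zy.
Qed.

Lemma lscD_continuous (T : topologicalType) (G : T -> \bar R) (t : R)
    (c : T -> R) : (0 < t)%R -> lower_semicontinuous G -> continuous c ->
  lower_semicontinuous (fun x => t%:E * G x + (c x)%:E).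
Proof.
move=> t0 Glsc cc x a axG.
have [b [ba bG]] : exists b : R, (a - c x < t * b)%R /\ b%:E < G x.
  move: axG; case: (G x) => [g||].
  - rewrite -EFinM -EFinD lte_fin => ag.
    exists (((a - c x) / t + g) / 2)%R.
    have agt : ((a - c x) / t < g)%R by rewrite ltr_pdivrMr// mulrC ltrBlDr.
    split; last by rewrite lte_fin midf_lt//.
    have := midf_lt agt; rewrite -(ltr_pM2l t0) => -[+ _].
    by rewrite [(t * (_ / t))%R]mulrC divfK ?gt_eqF.
  - move=> _; exists ((a - c x) / t + 1)%R; rewrite ltry; split => //.
    by rewrite mulrDr [(t * (_ / t))%R]mulrC divfK ?gt_eqF// ltrDl mulr1.
  - by rewrite gt0_muleNy ?lte_fin// addNye.
exists [set z | b%:E < G z /\ (a - t * b < c z)%R].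
  apply: filterI; first exact: lsc_near.
  have cab : (a - t * b < c x)%R by rewrite ltrBlDr -ltrBlDl.
  exact: (cvgr_gt _ (cc x) _ cab).
move=> z [bGz cz]; apply: (@lt_le_trans _ _ (t%:E * b%:E + (c z)%:E)).
  by rewrite -EFinM -EFinD lte_fin addrC -ltrBlDr.
by rewrite leeD// lee_pmul2l ?lte_fin// ltW.
Qed.

End LowerSemicontinuity.

Section ConvexFunctions.
Context {R : realType} {X : finHilbertType R}.
Implicit Types (G : X -> \bar R) (x y z g : X).

(** First-order conditions: divide a one-sided expansion by the step and let the
    step tend to zero. *)
Lemma slope_ge0 (a b : R) :
  (forall s, 0 < s -> s <= 1 -> 0 <= a + s * b) -> 0 <= a.
Proof.
move=> h; apply/ler_addgt0Pr => e e0.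
have b0 : 0 < `|b| + 1 by rewrite ltr_wpDl.
pose s := Num.min 1 (e / (`|b| + 1)).
have s0 : 0 < s by rewrite lt_min ltr01 divr_gt0.
have s1 : s <= 1 by rewrite ge_min lexx.
apply: le_trans (h s s0 s1) _; rewrite lerD2l.
apply: le_trans (ler_norm _) _; rewrite normrM gtr0_norm//.
have : s <= e / (`|b| + 1) by rewrite ge_min lexx orbT.
rewrite ler_pdivlMr//; apply: le_trans.
by apply: ler_wpM2l; [exact: ltW|rewrite lerDl].
Qed.

Lemma subdiff_fin G x g  : Defs.proper G -> subdiff G x g -> G x \is a fin_num.
Proof.
move=> [Gnoo [y Gy]] /(_ y); move: Gy (Gnoo x).
by case: (G x) => [r||]; case: (G y) => [s||].
Qed.

(** Minimising [G] over a ball around a point of its domain bounds [G] from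
    below there; convexity propagates this bound linearly to the outside. *)
Lemma pcc_lower_bound G : proper_closed_convex G ->
  exists (x0 : X) (g0 c D : R), [/\ G x0 = g0%:E, 0 <= D &
    forall x, ((c - D * `|x - x0|)%:E <= G x)%E].
Proof.
move=> [[Gnoo [x0 Gx0]] Glsc Gcvx].
have x0b : [set x : X | `|x| <= 1 + `|x0|] x0 by rewrite /= lerDr.
have [x1 _ x1min] := lsc_compact_min Glsc (@ball_compact R X (1 + `|x0|))
  (ex_intro _ x0 x0b).
have [g0 Gg0] : exists v : R, G x0 = v%:E.
  by case: (G x0) (Gnoo x0) Gx0 => [v||]// _ _; exists v.
have [c Gc] : exists v : R, G x1 = v%:E.
  have := x1min _ x0b; have := Gnoo x1; rewrite Gg0.
  by case: (G x1) => [v||]// _ _; exists v.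
have cg0 : c <= g0 by have := x1min _ x0b; rewrite Gc Gg0 lee_fin.
exists x0, g0, c, (g0 - c); rewrite subr_ge0; split=> // x.
have [x01|x01] := leP `|x - x0| 1.
  apply: (@le_trans _ _ c%:E).
    by rewrite lee_fin lerBlDr lerDl mulr_ge0// subr_ge0.
  rewrite -Gc; apply: x1min => /=; rewrite -[x in `|x|](subrK x0).
  by apply: le_trans (ler_normD _ _) _; rewrite lerD2r.
have n0 : 0 < `|x - x0| by exact: lt_trans x01.
pose s := `|x - x0|^-1.
have s0 : 0 < s by rewrite invr_gt0.
have s1 : 0 <= s <= 1 by rewrite ltW//= invf_le1// ltW.
have := Gcvx s x x0 s1; rewrite Gg0 => Gs.
have sb : [set x : X | `|x| <= 1 + `|x0|] (s *: x + (1 - s) *: x0).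
  rewrite /= (_ : _ + _ = s *: (x - x0) + x0).
    apply: le_trans (ler_normD _ _) _; rewrite lerD2r normrZ gtr0_norm//.
    by rewrite mulVf ?gt_eqF.
  by rewrite scalerBr scalerBl scale1r addrA addrAC.
move: (le_trans (x1min _ sb) Gs) (Gnoo x); rewrite Gc.
case: (G x) => [g||]// => [|_ _]; last by rewrite leey.
rewrite -!EFinM -EFinD !lee_fin => cs _.
have sn : s * `|x - x0| = 1 by rewrite mulVf ?gt_eqF.
by rewrite -(ler_pM2l s0); nra.
Qed.

Lemma prox_objective_min G (t : R) z : proper_closed_convex G -> 0 < t ->
  exists x, argmin (fun z' => t%:E * G z' + (2^-1 * `|z - z'| ^+ 2)%:E)%E x.
Proof.
move=> Gpcc t0; have [x0 [g0 [c [D [Gx0 D0 Gge]]]]] := pcc_lower_bound Gpcc.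
have [[Gnoo _] Glsc _] := Gpcc.
pose phi x := (t%:E * G x + (2^-1 * `|z - x| ^+ 2)%:E)%E.
have phi_lsc : lower_semicontinuous phi.
  apply: lscD_continuous => // x.
  have nx : `|z - z'| @[z' --> x] --> `|z - x|.
    by apply: cvg_norm; apply: cvgB; [exact: cvg_cst|exact: cvg_id].
  apply: cvgM; first exact: cvg_cst.
  by under eq_fun do rewrite expr2; apply: cvgM.
have cg0 : c <= g0.
  by have := Gge x0; rewrite Gx0 lee_fin subrr normr0 mulr0 subr0.
pose E := t * (g0 - c) + `|z - x0| ^+ 2.
have E0 : 0 <= E by rewrite addr_ge0 ?exprn_ge0// mulr_ge0 ?subr_ge0// ltW.
(* beyond this radius the quadratic term beats the linear lower bound *)
pose r := 4 * (t * D) + 1 + 4 * E.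
have tD0 : 0 <= t * D by rewrite mulr_ge0// ltW.
have x0b : [set x : X | `|x| <= r + `|x0|] x0.
  by rewrite /= lerDr /r; nra.
have [x1 x1b x1min] := lsc_compact_min phi_lsc (@ball_compact R X _)
  (ex_intro _ x0 x0b).
exists x1 => y.
have [yr|yr] := leP `|y| (r + `|x0|); first exact: x1min.
apply: le_trans (x1min _ x0b) _; rewrite /phi Gx0.
apply: (@le_trans _ _ (t%:E * (c - D * `|y - x0|)%:E + (2^-1 * `|z - y| ^+ 2)%:E)%E).
  rewrite -!EFinM -!EFinD lee_fin.
  have sr : r < `|y - x0|.
    by rewrite -(ltrD2r `|x0|) (lt_le_trans yr)// -lerBlDr lerB_dist.
  have : `|y - x0| ^+ 2 <= 2 * `|z - y| ^+ 2 + 2 * `|z - x0| ^+ 2.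
    have := sqr_ge0 `|(z - y) + (z - x0)|.
    rewrite (_ : y - x0 = (z - x0) - (z - y)); last by vect.
    by rewrite (sqr_normB (z - x0)) (sqr_normD (z - y)) (dotpC (z - y)); lra.
  have := sqr_ge0 `|z - y|; have := sqr_ge0 `|z - x0|.
  have s2 : r * `|y - x0| <= `|y - x0| ^+ 2.
    by rewrite expr2 ler_wpM2r// ltW.
  have s1 : 1 <= `|y - x0| by apply: ltW (le_lt_trans _ sr); rewrite /r; lra.
  have Es : E <= E * `|y - x0| by rewrite ler_peMr.
  by move: s2 Es; rewrite /r /E; lra.
by rewrite leeD// lee_pmul2l ?lte_fin.
Qed.


(** Compare the minimiser with the points of the segment to [y], and keep the
    first-order term. *)
Lemma argmin_subdiff G (t : R) z x : proper_closed_convex G -> 0 < t ->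
  argmin (fun z' => t%:E * G z' + (2^-1 * `|z - z'| ^+ 2)%:E)%E x ->
  subdiff G x (t^-1 *: (z - x)).
Proof.
move=> [[Gnoo [x0 Gx0]] _ Gcvx] t0 xmin.
have [h Gh] : exists v : R, G x = v%:E.
  have := xmin x0; case: (G x) (Gnoo x) => [v||]//= _; first by exists v.
  case: (G x0) Gx0 (Gnoo x0) => [v||]//= _ _.
  by rewrite gt0_muley ?lte_fin// addye.
move=> y; rewrite Gh; have := Gnoo y; case Gy : (G y) => [v||]// _; last first.
  by rewrite leey.
rewrite -EFinD lee_fin dotpZl -(ler_pM2l t0) mulrDr mulVKf ?gt_eqF// -subr_ge0.
apply: (@slope_ge0 _ (2^-1 * `|y - x| ^+ 2)) => s s0 s1.
have s01 : 0 <= s <= 1 by rewrite ltW.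
have := Gcvx s y x s01; rewrite Gy Gh -!EFinM -EFinD.
set q := (s *: y + _) => Gq.
have := xmin q; rewrite Gh -EFinM -EFinD.
case: (G q) (Gnoo q) Gq => [w||]// _; rewrite -EFinM -EFinD !lee_fin => Gq.
rewrite (_ : z - q = (z - x) - s *: (y - x)); last first.
  by rewrite /q; vect.
rewrite (sqr_normB _ (s *: _)) normrZ dotpZr exprMn gtr0_norm// => le1.
by rewrite -(pmulr_rge0 _ s0); have := ler_wpM2l (ltW t0) Gq; lra.
Qed.

Lemma prox_subdiff G (t : R) z : proper_closed_convex G -> 0 < t ->
  let x := prox (fun z' => t%:E * G z')%E z in subdiff G x (t^-1 *: (z - x)).
Proof.
move=> Gpcc t0 /=; apply: argmin_subdiff => //.
exact: (xgetPex 0 (prox_objective_min z Gpcc t0)).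
Qed.

(** Moreau's decomposition, read off the optimality conditions: [prox] of the
    conjugate is computed from the minimiser defining [prox] of [G] itself,
    which avoids any appeal to the biconjugate. *)
Lemma prox_conjugate_subdiff G (t : R) z : proper_closed_convex G -> 0 < t ->
  let u := prox (fun v => t%:E * conjugate G v)%E z in
  subdiff G (t^-1 *: (z - u)) u.
Proof.
move=> Gpcc t0 /=; have ti0 : 0 < t^-1 by rewrite invr_gt0.
have [q qmin] := prox_objective_min (t^-1 *: z) Gpcc ti0.
have Gpr : Defs.proper G by case: Gpcc.
have := argmin_subdiff Gpcc ti0 qmin; rewrite invrK scalerBr scalerKV ?gt_eqF//.
pose u0 := z - t *: q; rewrite -/u0 => Gu0.
suff -> : prox (fun v => t%:E * conjugate G v)%E z = u0.
  by rewrite /u0 opprB addrC subrK scalerK ?gt_eqF.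
have /fineK Gq := subdiff_fin Gpr Gu0.
move: (fine _) Gq => h /esym Gq.
have conj_ge v : ((dotp v q - h)%:E <= conjugate G v)%E.
  by apply: ereal_sup_ubound; exists q => //; rewrite Gq.
have conj_u0 : conjugate G u0 = (dotp u0 q - h)%:E.
  apply/eqP; rewrite eq_le conj_ge andbT; apply: ub_ereal_sup => _ [x _ <-].
  have := Gu0 x; rewrite Gq; case: (G x) => [v||]//.
    by rewrite -EFinD -EFinB !lee_fin dotpDr dotpNr; lra.
  by rewrite addeNy// leNye.
have obj_ge v : ((t * (dotp u0 q - h) + 2^-1 * `|z - u0| ^+ 2
    + 2^-1 * `|v - u0| ^+ 2)%:E
    <= t%:E * conjugate G v + (2^-1 * `|z - v| ^+ 2)%:E)%E.
  apply: (@le_trans _ _ (t%:E * (dotp v q - h)%:E + (2^-1 * `|z - v| ^+ 2)%:E)%E).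
    rewrite -EFinM -EFinD lee_fin.
    rewrite (_ : z - v = (z - u0) - (v - u0)); last by vect.
    rewrite (sqr_normB (z - u0)) (_ : dotp (z - u0) (v - u0) = t * dotp q (v - u0)).
      by rewrite dotpDr dotpNr !(dotpC q); nra.
    by rewrite /u0 opprB addrC subrK dotpZl.
  by rewrite leeD// lee_pmul2l ?lte_fin.
apply: xget_unique => [v|v vmin].
  rewrite conj_u0; apply: le_trans (obj_ge v); rewrite -EFinM -EFinD lee_fin.
  by rewrite lerDl mulr_ge0// exprn_ge0.
have := le_trans (obj_ge v) (vmin u0); rewrite conj_u0 -EFinM -EFinD lee_fin.
rewrite gerDl pmulr_rle0// => vu0; apply/eqP; rewrite -subr_eq0 -normr_eq0.
by rewrite -sqrf_eq0 eq_le vu0 exprn_ge0.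
Qed.

Lemma subdiff_monotone G x y g h : Defs.proper G -> subdiff G x g ->
  subdiff G y h -> 0 <= dotp (g - h) (x - y).
Proof.
move=> Gpr gx hy.
have /fineK Gx := subdiff_fin Gpr gx; have /fineK Gy := subdiff_fin Gpr hy.
have := gx y; have := hy x; rewrite -Gx -Gy -!EFinD !lee_fin !dotpE; lra.
Qed.

(** Only the value of [G] at the moving point needs care, and there lower
    semicontinuity gives the inequality in the right direction. *)
Lemma subdiff_closed G (T : Type) (FF : set_system T) {FFF : ProperFilter FF}
    (x g : T -> X) (x0 g0 : X) :
  proper_closed_convex G -> (\forall t \near FF, subdiff G (x t) (g t)) ->
  x @ FF --> x0 -> g @ FF --> g0 -> subdiff G x0 g0.
Proof.
move=> [[Gnoo _] Glsc _] sxg xx0 gg0 y.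
have := Gnoo y; case Gy : (G y) => [v||]// _; last by rewrite leey.
have cvg_aff : (fun t => v - dotp (g t) (y - x t)) @ FF --> v - dotp g0 (y - x0).
  apply: cvgB; first exact: cvg_cst.
  by apply: cvg_dotp => //; apply: cvgB => //; exact: cvg_cst.
suff le1 : (G x0 <= (v - dotp g0 (y - x0))%:E)%E.
  by apply: le_trans (leeD2r _ le1) _; rewrite -EFinD lee_fin subrK.
rewrite leNgt; apply/negP => lt1.
(* a real strictly between the affine bound and [G x0] separates their values
   near the limit *)
have [a [va aG]] : exists a : R, v - dotp g0 (y - x0) < a /\ (a%:E < G x0)%E.
  case: (G x0) lt1 => [h||]//=.
    rewrite lte_fin => vh; exists ((v - dotp g0 (y - x0) + h) / 2).
    by rewrite lte_fin !midf_lt.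
  by move=> _; exists (v - dotp g0 (y - x0) + 1); rewrite ltry ltrDl.
have : \forall t \near FF, False.
  have near_a : \forall t \near FF, v - dotp (g t) (y - x t) < a.
    exact: (cvgr_lt _ cvg_aff).
  near=> t.
  have xa : (a%:E < G (x t))%E.
    by near: t; exact: (xx0 _ (lsc_near Glsc aG)).
  have sub : subdiff G (x t) (g t) by near: t.
  have lta : v - dotp (g t) (y - x t) < a by near: t.
  have := sub y; rewrite Gy; move: xa (Gnoo (x t)).
  by case: (G (x t)) => [w||]// + _; rewrite -EFinD lte_fin lee_fin; lra.
by case/filter_ex.
Unshelve. all: by end_near.
Qed.

End ConvexFunctions.

(** * Smooth convex functions *)

Section SmoothConvex.
Context {R : realType} {X : finHilbertType R}.
Implicit Types (F : X -> R) (x y d : X).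

Lemma dotp_gradient F x d : dotp d (gradient F x) = 'd F x d.
Proof.
pose f : X -> R := 'd F x.
have fl : scalar f by move=> t a b; rewrite /f linearP.
pose lf : {scalar X} := HB.pack f (GRing.isLinear.Build _ _ _ _ f fl).
by rewrite /gradient -(rieszP lf).
Qed.

Lemma convex_functionP F : convex_function [set: X] F ->
  forall s x y, 0 <= s <= 1 ->
  F (s *: x + (1 - s) *: y) <= s * F x + (1 - s) * F y.
Proof.
move=> Fc s x y s01.
pose t : {i01 R} := Itv01 (proj1 (andP s01)) (proj2 (andP s01)).
have := Fc t x y; rewrite !inE => /(_ Logic.I Logic.I).
by rewrite convRE.
Qed.


Lemma is_derive_line F x d (s : R) : differentiable F (s *: d + x) ->
  is_derive s 1 (fun s => F (s *: d + x)) (dotp d (gradient F (s *: d + x))).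
Proof.
move=> dF; set f := fun s => _.
have quotE : (fun h : R => h^-1 *: ((f \o shift s) (h *: 1) - f s)) =
    (fun h : R => h^-1 *: ((F \o shift (s *: d + x)) (h *: d) - F (s *: d + x))).
  by apply/funext => h; rewrite /f /= scaler1 scalerDl addrA.
have dvF : derivable F (s *: d + x) d by exact: diff_derivable.
apply: DeriveDef; first by rewrite /derivable quotE.
by rewrite /derive quotE -/(derive F _ d) deriveE// dotp_gradient.
Qed.

Lemma gradient_le F x y : convex_function [set: X] F -> differentiable F x ->
  F x + dotp (gradient F x) (y - x) <= F y.
Proof.
move=> /convex_functionP Fc dF; rewrite -lerBrDl dotpC.
have dvF : derivable F x (y - x) by exact: diff_derivable.
rewrite dotp_gradient -deriveE//.
apply: (cvgr_to_le (cvg_dnbhs_at_right dvF)); near=> s => /=.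
have s0 : 0 < s by [].
have s01 : 0 <= s <= 1 by rewrite ltW//=; near: s; exact: nbhs_right_le.
rewrite (_ : s *: (y - x) + x = s *: y + (1 - s) *: x); last by vect.
rewrite /GRing.scale /= ler_pdivrMl//; have := Fc s y x s01; lra.
Unshelve. all: by end_near.
Qed.

(** The mean value theorem, applied to the restriction of [F] to the segment
    minus the quadratic that bounds it. *)
Lemma descent_lemma F (L : R) x y : smooth L F ->
  F y <= F x + dotp (gradient F x) (y - x) + L / 2 * `|y - x| ^+ 2.
Proof.
move=> [dF gL]; pose d := y - x.
pose f s := F (s *: d + x) - (dotp d (gradient F x) * s
  + L / 2 * `|d| ^+ 2 * s ^+ 2).
pose df s := dotp d (gradient F (s *: d + x)) - (dotp d (gradient F x)
  + L / 2 * `|d| ^+ 2 * (s *+ 2)).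
have f_der (s : R) : is_derive s 1 f (df s).
  have Fd : is_derive s 1 (fun s => F (s *: d + x)) _ :=
    @is_derive_line F x d s (dF _).
  rewrite /f /df; apply: is_deriveB; apply: is_deriveD.
    have := is_deriveZ (dotp d (gradient F x)) (is_derive_id s 1).
    by rewrite /GRing.scale /= mulr1.
  have := is_deriveZ (L / 2 * `|d| ^+ 2) (is_deriveX 2 (is_derive_id s 1)).
  by rewrite /GRing.scale /= mulr1 expr1 mulr_natl.
have [|c] := @MVT_segment R f df 0 1 ler01 (fun s _ => f_der s).
  apply/continuous_subspaceT => s; apply: differentiable_continuous.
  by apply/derivable1_diffP; case: (f_der s).
rewrite in_itv /= => /andP[c0 c1].
rewrite /f /df !scale1r !scale0r subrK add0r expr1n expr0n subr0 !mulr1 !mulr0.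
rewrite addr0 subr0 (dotpC d (gradient F x)) -/d => fE.
have gd : dotp d (gradient F (c *: d + x)) - dotp d (gradient F x)
    <= L * `|d| ^+ 2 * c.
  rewrite -dotpNr -dotpDr; apply: le_trans (dotp_le_norm _ _) _.
  apply: le_trans (ler_wpM2l _ (gL _ _)) _ => //.
  by rewrite addrK normrZ ger0_norm//; lra.
have arith (a b e g q r : R) :
  b - (g + q) - a = e - (g + r) -> e - g <= r -> b <= a + g + q by lra.
apply: (arith _ _ _ _ _ _ fE); rewrite (dotpC (gradient F x) d).
by apply: le_trans gd _; rewrite -[c *+ 2]mulr_natl; lra.
Qed.

(** Baillon-Haddad: compare the tangent at [x] with the descent bound at [y] in
    the point that minimises their difference. *)
Lemma smooth_convex_lower F (L : R) x y : 0 < L -> convex_function [set: X] F ->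
  smooth L F ->
  F x + dotp (gradient F x) (y - x)
    + (2 * L)^-1 * `|gradient F y - gradient F x| ^+ 2 <= F y.
Proof.
move=> L0 Fc Fs; have [dF _] := Fs.
have := gradient_le (y - L^-1 *: (gradient F y - gradient F x)) Fc (dF x).
have := descent_lemma y (y - L^-1 *: (gradient F y - gradient F x)) Fs.
move: (gradient F x) (gradient F y) => gx gy; set g := gy - gx.
rewrite (_ : y - L^-1 *: g - y = - (L^-1 *: g)); last by vect.
rewrite (_ : y - L^-1 *: g - x = (y - x) - L^-1 *: g); last by vect.
rewrite normrN normrZ exprMn gtr0_norm ?invr_gt0// (dotpDr gx) !dotpNr !dotpZr.
have gE : dotp gy g - dotp gx g = `|g| ^+ 2.
  by rewrite sqr_norm_dotp {3}/g !dotpE.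
have -> : L / 2 * (L^-1 ^+ 2 * `|g| ^+ 2) = (2 * L)^-1 * `|g| ^+ 2.
  by field; rewrite gt_eqF.
have := congr1 (fun t => L^-1 * t) gE.
rewrite (_ : L^-1 * `|g| ^+ 2 = 2 * ((2 * L)^-1 * `|g| ^+ 2)); last first.
  by field; rewrite gt_eqF.
by lra.
Qed.

(** Add the two instances of [smooth_convex_lower]. *)
Lemma gradient_cocoercive F (L : R) x y : 0 < L ->
  convex_function [set: X] F -> smooth L F ->
  `|gradient F x - gradient F y| ^+ 2
    <= L * dotp (gradient F x - gradient F y) (x - y).
Proof.
move=> L0 Fc Fs.
have := smooth_convex_lower x y L0 Fc Fs.
have := smooth_convex_lower y x L0 Fc Fs.
rewrite (distrC (gradient F y)); move: (gradient F x) (gradient F y) => gx gy.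
rewrite -(ler_pM2l L0) !mulrDr.
set a := (2 * L)^-1 * _.
have Na : L * a = 2^-1 * `|gx - gy| ^+ 2.
  by rewrite /a; field; rewrite gt_eqF.
rewrite Na !dotpE => h1; rewrite -(ler_pM2l L0) !mulrDr Na; lra.
Qed.

Lemma gradient_cst0 F x : (forall z, F z = 0) -> gradient F x = 0.
Proof.
move=> F0; apply: dotp_ext => h; rewrite dotp_gradient dotp0r.
by rewrite (_ : F = cst 0) ?diff_cst//; apply/funext => z; rewrite F0.
Qed.

Lemma smooth_gradient_cvg F (L : R) (T : Type) (FF : set_system T)
    {FFF : Filter FF} (f : T -> X) x : smooth L F ->
  f @ FF --> x -> (fun t => gradient F (f t)) @ FF --> gradient F x.
Proof.
move=> [_ gL] fx; apply/cvgrPdist_lt => e e0.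
have L1 : 0 < `|L| + 1 by rewrite ltr_wpDl.
have : 0 < e / (`|L| + 1) by rewrite divr_gt0.
move/cvgrPdist_lt : fx => /[apply]; apply: filterS => t.
rewrite ltr_pdivlMr// mulrC; apply: le_lt_trans; apply: le_trans (gL _ _) _.
by rewrite ler_wpM2r// (le_trans (ler_norm _))// lerDl.
Qed.

End SmoothConvex.

(** * The energy of one block *)

Section BlockEnergy.
Context {R : realType} {X Y : finHilbertType R} (K : {linear X -> Y}).
Implicit Types (c eta L : R) (d e g : X) (v : Y).

(** The squared norm of [d + c *: adjoint K v], the variable of Davis-Yin
    splitting, plus [c ^+ 2 * (eta * |v|^2 - |adjoint K v|^2)]: the supplement,
    nonnegative by [adjoint_le], measures [v] itself and not only its image. *)
Definition block_energy c eta d v : R :=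
  `|d| ^+ 2 + 2 * c * dotp (K d) v + c ^+ 2 * eta * `|v| ^+ 2.

(** Polarisation of the energy at the increment, with its cross term rearranged
    so that the inclusions satisfied by one step of the algorithm appear. *)
Lemma block_energy_step c eta d d' v v' g :
  block_energy c eta d' v' = block_energy c eta d v
    - block_energy c eta (d' - d) (v' - v)
    - 2 * c * dotp (K d - (c * eta) *: (v' - v)) v'
    - 2 * dotp (d - c *: adjoint K (v' - v) - c *: g - c *: adjoint K v' - d') d'
    - 2 * c * dotp g d'.
Proof.
have p'E := dotp_adjointl K d' v'; have pE := dotp_adjointl K d' (v' - v).
rewrite /block_energy; move: (adjoint K (v' - v)) (adjoint K v') pE p'E => p p'.
rewrite (_ : K (d' - d) = K d' - K d); last exact: linearB.
rewrite !sqr_norm_dotp !dotpE => -> ->.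
rewrite (dotpC v' v) (dotpC d' d) (dotpC v' (K d')) (dotpC v (K d')).
ring.
Qed.

(** The bound of [K] passes to its adjoint by expanding the square
    [|eta *: v - K (adjoint K v)|^2]. *)
Lemma adjoint_le eta v : 0 < eta -> (forall z, `|K z| ^+ 2 <= eta * `|z| ^+ 2) ->
  `|adjoint K v| ^+ 2 <= eta * `|v| ^+ 2.
Proof.
move=> eta0 Kle; rewrite -(ler_pM2l eta0); have := sqr_ge0 `|eta *: v - K (adjoint K v)|.
rewrite sqr_normB normrZ exprMn gtr0_norm// dotpZl -dotp_adjointl -sqr_norm_dotp.
have := Kle (adjoint K v); lra.
Qed.

Lemma block_energy_ge c eta d v : 0 < eta ->
  (forall z, `|K z| ^+ 2 <= eta * `|z| ^+ 2) ->
  `|d + c *: adjoint K v| ^+ 2 <= block_energy c eta d v.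
Proof.
move=> eta0 /(adjoint_le v eta0) Kv.
rewrite sqr_normD normrZ exprMn real_normK ?num_real// dotpZr dotp_adjoint.
have := ler_wpM2l (sqr_ge0 c) Kv; rewrite /block_energy; lra.
Qed.

(** The cocoercivity of the gradient pays for evaluating it at the block point
    [d - c *: adjoint K (v' - v)] instead of [d'], and leaves a fraction of the
    energy of the increment as long as [c < 2 / L]. *)
Lemma block_energy_forward c eta L rho d d' v v' g :
  0 < c -> 0 < eta -> 0 < L -> rho <= 1 - c * L / 2 ->
  (forall z, `|K z| ^+ 2 <= eta * `|z| ^+ 2) ->
  let dx := d - c *: adjoint K (v' - v) in
  `|g| ^+ 2 <= L * dotp g dx ->
  0 <= dotp (K d - (c * eta) *: (v' - v)) v' ->
  block_energy c eta d' v' + rho * block_energy c eta (d' - d) (v' - v)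
    <= block_energy c eta d v
       - 2 * dotp (dx - c *: g - c *: adjoint K v' - d') d'.
Proof.
move=> c0 eta0 L0 rho1 Kle dx gdx A0.
have E0 := block_energy_ge c (d' - d) (v' - v) eta0 Kle.
have dE : (d' - d) + c *: adjoint K (v' - v) = d' - dx.
  by rewrite /dx opprB addrA addrAC.
rewrite dE in E0.
have L20 : 0 < 2 / L by rewrite divr_gt0.
have Young := dotp_young (- g) (d' - dx) L20.
rewrite normrN dotpNl dotpDr dotpNr invf_div in Young.
have gdxL : 2 / L * `|g| ^+ 2 <= 2 * dotp g dx.
  by rewrite mulrAC ler_pdivrMr// -mulrA ler_pM2l// mulrC.
rewrite (block_energy_step c eta d d' v v' g) -/dx.
set B := dotp _ d' in A0 *; set A := dotp (K d - _) v' in A0 *.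
have A2 : 0 <= 2 * c * A by rewrite mulr_ge0// mulr_ge0// ltW.
have gd' : - (2 * c * dotp g d') <= c * L / 2 * `|d' - dx| ^+ 2.
  rewrite -(ler_pM2l c0) in gdxL; move: Young; rewrite -(ler_pM2l c0); lra.
have rE : rho * block_energy c eta (d' - d) (v' - v) <=
    (1 - c * L / 2) * block_energy c eta (d' - d) (v' - v).
  by rewrite ler_wpM2r// (le_trans _ E0)// exprn_ge0.
have cE : c * L / 2 * `|d' - dx| ^+ 2 <=
    c * L / 2 * block_energy c eta (d' - d) (v' - v).
  by rewrite ler_wpM2l// mulr_ge0// mulr_ge0// ltW.
lra.
Qed.

(** Nonexpansiveness of the dual proximal step, whose argument is
    [K d + (c * eta) *: v] up to a factor. *)
Lemma dual_step_le c eta d v v' : 0 < c -> 0 < eta ->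
  0 <= dotp (K d - (c * eta) *: (v' - v)) v' ->
  (c * eta) ^+ 2 * `|v'| ^+ 2 <= `|K d + (c * eta) *: v| ^+ 2.
Proof.
move=> c0 eta0; have ce0 : 0 < c * eta by rewrite mulr_gt0.
rewrite (_ : K d - _ = (K d + (c * eta) *: v) - (c * eta) *: v'); last by vect.
have := dotp_young (K d + (c * eta) *: v) ((c * eta) *: v') ltr01.
rewrite !dotpE -sqr_norm_dotp normrZ exprMn gtr0_norm// invr1 !mul1r.
move=> h1 h2.
have : 0 <= (c * eta) * (dotp (K d) v' + c * eta * dotp v v' - c * eta * `|v'| ^+ 2).
  by rewrite mulr_ge0// ltW.
lra.
Qed.

End BlockEnergy.

(** * The energy of all blocks *)

Section Energy.
Context {R : realType} {X : finHilbertType R} {M : nat}.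
Context {U : 'I_M -> finHilbertType R} (K : forall m, {linear X -> U m}).
Context (w c : 'I_M -> R) (eta : R).
Hypothesis (w0 : forall m, 0 < w m) (w1 : \sum_(m < M) w m = 1).
Hypothesis (eta0 : 0 < eta).
(** The common consequence of the two ways of measuring the operators jointly. *)
Hypothesis K_le : forall z, \sum_(m < M) w m * `|K m z| ^+ 2 <= eta * `|z| ^+ 2.
Implicit Types (d : X) (v : forall m, U m).

Definition energy d v : R :=
  \sum_(m < M) w m * block_energy (K m) (c m) eta d (v m).

Let S v := \sum_(m < M) (w m * c m) *: adjoint (K m) (v m).
Let Q v := \sum_(m < M) w m * (c m ^+ 2 * `|v m| ^+ 2).

Let dotp_S d v : dotp d (S v) = \sum_(m < M) w m * (c m * dotp (K m d) (v m)).
Proof.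
rewrite /S dotp_sumr; apply: eq_bigr => m _.
by rewrite dotpZr dotp_adjoint mulrA.
Qed.

Let energyE d v : energy d v = `|d| ^+ 2 + 2 * dotp d (S v) + eta * Q v.
Proof.
have -> : `|d| ^+ 2 = \sum_(m < M) w m * `|d| ^+ 2.
  by rewrite -mulr_suml w1 mul1r.
rewrite dotp_S /energy /Q !mulr_sumr -!big_split; apply: eq_bigr => m _ /=; rewrite /block_energy; ring.
Qed.

(* the argument of [adjoint_le], for the operator that maps [v] to [S v] *)
Let sum_residual v :
  \sum_(m < M) w m * `|(c m * eta) *: v m - K m (S v)| ^+ 2
    <= eta * (eta * Q v - `|S v| ^+ 2).
Proof.
have SE : `|S v| ^+ 2 = \sum_(m < M) w m * (c m * dotp (K m (S v)) (v m)).
  by rewrite sqr_norm_dotp dotp_S.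
have -> : \sum_(m < M) w m * `|(c m * eta) *: v m - K m (S v)| ^+ 2 =
    eta ^+ 2 * Q v - 2 * eta * `|S v| ^+ 2
    + \sum_(m < M) w m * `|K m (S v)| ^+ 2; last by have := K_le (S v); lra.
rewrite SE /Q !mulr_sumr -sumrN -!big_split; apply: eq_bigr => m _ /=.
rewrite sqr_normB normrZ exprMn real_normK ?num_real// dotpZl (dotpC (v m)) /=.
ring.
Qed.

Let S_le v : `|S v| ^+ 2 <= eta * Q v.
Proof.
rewrite -subr_ge0 -(pmulr_rge0 _ eta0); apply: le_trans (sum_residual v).
by apply: sumr_ge0 => m _; rewrite mulr_ge0 ?exprn_ge0// ltW.
Qed.

Lemma energy_ge0 d v : 0 <= energy d v.
Proof.
have := sqr_ge0 `|d + S v|; rewrite sqr_normD energyE.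
by have := S_le v; lra.
Qed.

(** The energy is the square of [d + S v] plus a residual, and may vanish away
    from zero. Both parts bound their share of
    [K d + (c * eta) *: v = K (d + S v) + ((c * eta) *: v - K (S v))]. *)
Lemma energy_block_le m d v :
  w m * `|K m d + (c m * eta) *: v m| ^+ 2 <= 2 * eta * energy d v.
Proof.
apply: (@le_trans _ _
    (\sum_(i < M) w i * `|K i d + (c i * eta) *: v i| ^+ 2)).
  rewrite (bigD1 m)//= lerDl; apply: sumr_ge0 => i _.
  by rewrite mulr_ge0 ?exprn_ge0// ltW.
have zS : `|d + S v| ^+ 2 = energy d v - (eta * Q v - `|S v| ^+ 2).
  by rewrite sqr_normD energyE; ring.
apply: (@le_trans _ _ (\sum_(i < M) (2 * (w i * `|K i (d + S v)| ^+ 2)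
    + 2 * (w i * `|(c i * eta) *: v i - K i (S v)| ^+ 2)))).
  apply: ler_sum => i _.
  rewrite (_ : K i d + _ = K i (d + S v) + ((c i * eta) *: v i - K i (S v))).
    have := dotp_young (K i (d + S v)) ((c i * eta) *: v i - K i (S v)) ltr01.
    move/(ler_wpM2l (ltW (w0 i))).
    by rewrite invr1 !mul1r (sqr_normD (K i (d + S v))); lra.
  by rewrite (_ : K i (d + S v) = K i d + K i (S v)) ?linearD//; vect.
rewrite big_split -!mulr_sumr /=.
have := K_le (d + S v); have := sum_residual v; rewrite zS; lra.
Qed.

Lemma primal_le_energy d v : `|d| ^+ 2 <=
  2 * energy d v + 2 * eta * \sum_(m < M) w m * (c m ^+ 2 * `|v m| ^+ 2).
Proof.
have := sqr_ge0 `|d + 2 *: S v|; have := S_le v.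
rewrite energyE sqr_normD normrZ exprMn real_normK ?num_real// dotpZr -/(Q v).
lra.
Qed.

(** Meant for the energy [e0] of one iterate and the pair [(d, v)] of the next:
    the premise is what [energy_block_le] and [dual_step_le] provide. *)
Lemma primal_le_energies (e0 : R) d v :
  (forall m, w m * ((c m * eta) ^+ 2 * `|v m| ^+ 2) <= 2 * eta * e0) ->
  `|d| ^+ 2 <= 2 * energy d v + 4 * M%:R * e0.
Proof.
move=> ve; apply: le_trans (primal_le_energy d v) _; rewrite lerD2l.
have -> : 4 * M%:R * e0 = 2 * \sum_(m < M) 2 * e0.
  by rewrite sumr_const card_ord -mulr_natr; ring.
rewrite -mulrA ler_pM2l// mulr_sumr; apply: ler_sum => m _.
by rewrite -(ler_pM2l eta0); have := ve m; lra.
Qed.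

Lemma energy_cvg0 (T : Type) (FF : set_system T) {FFF : Filter FF}
    (d : T -> X) (v : T -> forall m, U m) :
  d @ FF --> 0 -> (forall m, (fun t => v t m) @ FF --> 0) ->
  (fun t => energy (d t) (v t)) @ FF --> 0.
Proof.
move=> d0 v0.
have sqr0 (Y : finHilbertType R) (f : T -> Y) : f @ FF --> 0 ->
    (fun t => `|f t| ^+ 2) @ FF --> 0.
  move=> f0; under eq_fun do rewrite sqr_norm_dotp.
  by rewrite -(dotp0r (0 : Y)); exact: cvg_dotp.
rewrite (_ : 0 = \sum_(m < M) w m * (0 + 2 * c m * 0 + c m ^+ 2 * eta * 0)).
  apply: cvg_big => [|m _]; first exact: add_continuous.
  apply: cvgM; first exact: cvg_cst.
  apply: cvgD; [apply: cvgD|]; [exact: sqr0| |].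
    apply: cvgM; first exact: cvg_cst.
    rewrite -(dotp0r (K m 0)); apply: cvg_dotp => //; exact: linear_cvg.
  by apply: cvgM; [exact: cvg_cst|exact: sqr0].
by rewrite big1// => m _; rewrite !mulr0 !addr0 mulr0.
Qed.

End Energy.

(** * Convergence of the iterates *)

(** The optimality system that keeps the subgradients of the [H m] as unknowns:
    they are the limits of the dual iterates. *)
Definition saddle {R : realType} {X : finHilbertType R} {M : nat}
    {U : 'I_M -> finHilbertType R} (K : forall m, {linear X -> U m})
    (F : 'I_M -> X -> R) (H : forall m, U m -> \bar R) (Rg : X -> \bar R)
    (xs : X) (us : forall m, U m) : Prop :=
  (forall m, subdiff (@H m) (K m xs) (us m)) /\
  subdiff Rg xs (- (M%:R^-1 *: \sum_(m < M)
                     (gradient (F m) xs + adjoint (K m) (us m)))).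

Section Convergence.
Context {R : realType} {X : finHilbertType R} {M : nat}.
Context {U : 'I_M -> finHilbertType R} (K : forall m, {linear X -> U m}).
Context (F : 'I_M -> X -> R) (LF : 'I_M -> R).
Context (H : forall m, U m -> \bar R) (Rg : X -> \bar R).
Context (w : 'I_M -> R) (gamma eta rho : R).
Context (xR : nat -> X) (x : 'I_M -> nat -> X) (u : forall m, nat -> U m).
Let c m := gamma / (M%:R * w m).

Hypothesis (Rg_pcc : proper_closed_convex Rg).
Hypothesis (H_pcc : forall m, proper_closed_convex (@H m)).
Hypothesis (LF0 : forall m, 0 < LF m).
Hypothesis (F_convex : forall m, convex_function [set: X] (F m)).
Hypothesis (F_smooth : forall m, smooth (LF m) (F m)).
Hypothesis (w0 : forall m, 0 < w m) (w1 : \sum_(m < M) w m = 1).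
Hypothesis (gamma0 : 0 < gamma) (eta0 : 0 < eta).
Hypothesis (rho0 : 0 < rho) (rho_le : forall m, rho <= 1 - c m * LF m / 2).
Hypothesis K_le : forall z, \sum_(m < M) w m * `|K m z| ^+ 2 <= eta * `|z| ^+ 2.
Hypothesis K_le_or_F0 : (forall m z, `|K m z| ^+ 2 <= eta * `|z| ^+ 2) \/
  (forall m z, F m z = 0).

Hypothesis dual_inclusion : forall m k,
  subdiff (@H m) (K m (xR k) - (c m * eta) *: (u m k.+1 - u m k)) (u m k.+1).
Hypothesis block_update : forall m k,
  x m k.+1 = xR k - c m *: adjoint (K m) (u m k.+1 - u m k).
Hypothesis primal_inclusion : forall k, subdiff Rg (xR k.+1)
  (gamma^-1 *: (\sum_(m < M) w m *: (x m k.+1 - c m *: gradient (F m) (x m k.+1)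
     - c m *: adjoint (K m) (u m k.+1)) - xR k.+1)).

Let M0 : (0 < M)%N.
Proof. by case: M w w1 => // w'; rewrite big_ord0 => /esym/eqP; rewrite oner_eq0. Qed.

Let MR0 : 0 < M%:R :> R. Proof. by rewrite ltr0n. Qed.

Let c0 m : 0 < c m. Proof. by rewrite /c divr_gt0// mulr_gt0. Qed.

Let wcE m : w m * c m = gamma * M%:R^-1.
Proof. by rewrite /c; field; rewrite !gt_eqF. Qed.

Let V xs us k := energy K w c eta (xR k - xs) (fun m => u m k - us m).
Let DV k := energy K w c eta (xR k.+1 - xR k) (fun m => u m k.+1 - u m k).

Let DV_ge0 k : 0 <= DV k. Proof. exact: energy_ge0. Qed.
Let V_ge0 xs us k : 0 <= V xs us k. Proof. exact: energy_ge0. Qed.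

Let subBB (Y : zmodType) (a b z : Y) : (a - z) - (b - z) = a - b.
Proof. by rewrite opprB addrA subrK. Qed.

Let KB m a b : K m (a - b) = K m a - K m b. Proof. exact: linearB. Qed.

Let dual_monotone xs us m k : saddle K F H Rg xs us ->
  0 <= dotp (K m (xR k - xs) - (c m * eta) *: ((u m k.+1 - us m) - (u m k - us m)))
            (u m k.+1 - us m).
Proof.
move=> [Hs _]; have Hpr : Defs.proper (@H m) by case: (H_pcc m).
have := subdiff_monotone Hpr (@dual_inclusion m k) (Hs m).
by rewrite dotpC subBB KB addrAC.
Qed.

Let dual_increment_monotone m k :
  0 <= dotp (K m (xR k.+1 - xR k)
         - (c m * eta) *: ((u m k.+2 - u m k.+1) - (u m k.+1 - u m k)))
        (u m k.+2 - u m k.+1).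
Proof.
have Hpr : Defs.proper (@H m) by case: (H_pcc m).
have := subdiff_monotone Hpr (@dual_inclusion m k.+1) (@dual_inclusion m k).
rewrite dotpC; congr (0 <= dotp _ _).
rewrite KB.
by move: (K m _) (K m _) (u m _) (u m _) (u m _) => a b v v' v''; vect.
Qed.

Let primal_residual xs us k m := dotp ((xR k - xs)
      - c m *: adjoint (K m) ((u m k.+1 - us m) - (u m k - us m))
      - c m *: (gradient (F m) (x m k.+1) - gradient (F m) xs)
      - c m *: adjoint (K m) (u m k.+1 - us m) - (xR k.+1 - xs)) (xR k.+1 - xs).

(** The last inner product of [block_energy_step] has no sign in a single
    block: only its average over the blocks is the monotonicity of the
    subdifferential of [Rg]. *)
Let primal_monotone xs us k : saddle K F H Rg xs us ->
  0 <= \sum_(m < M) w m * primal_residual xs us k m.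
Proof.
move=> [_ Rs]; have Rpr : Defs.proper Rg by case: Rg_pcc.
have := subdiff_monotone Rpr (primal_inclusion k) Rs.
set r := _ - - _.
have -> : r = gamma^-1 *: \sum_(m < M) w m *: ((xR k - xs)
      - c m *: adjoint (K m) ((u m k.+1 - us m) - (u m k - us m))
      - c m *: (gradient (F m) (x m k.+1) - gradient (F m) xs)
      - c m *: adjoint (K m) (u m k.+1 - us m) - (xR k.+1 - xs)).
  have MV : M%:R^-1 = gamma^-1 * (gamma * M%:R^-1) by rewrite mulKf ?gt_eqF.
  rewrite /r opprK MV -scalerA -scalerDr; congr (_ *: _).
  rewrite -[X in _ - X + _]scale1r -[in X in _ - X + _]w1 scaler_suml scaler_sumr.
  rewrite -sumrN -!big_split; apply: eq_bigr => m _ /=; rewrite -(wcE m) subBB.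
  rewrite (block_update m k) (adjointB _ _ (us m)).
  move: (gradient (F m) xs) (gradient (F m) _) => g g'.
  move: (adjoint (K m) (us m)) (adjoint (K m) _) (adjoint (K m) _) => ps p' p.
  by vect.
rewrite dotpZl pmulr_rge0 ?invr_gt0// dotp_suml; congr (0 <= _).
by apply: eq_bigr => m _; rewrite dotpZl.
Qed.

(** Fejer monotonicity. When the [F m] vanish, the energy of a single block of
    the increment may be negative, and only the sum over the blocks can be
    multiplied by [rho]. *)
Let energy_descent xs us k : saddle K F H Rg xs us ->
  V xs us k.+1 + rho * DV k <= V xs us k.
Proof.
move=> sad; have := primal_monotone k sad.
pose B := primal_residual xs us k; rewrite -/B => B0.
have sumE f g : \sum_(m < M) w m * (f m - 2 * g m) =
    \sum_(m < M) w m * f m - 2 * \sum_(m < M) w m * g m.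
  rewrite mulr_sumr -sumrN -big_split; apply: eq_bigr => m _ /=; ring.
have VB : \sum_(m < M) w m *
      (block_energy (K m) (c m) eta (xR k - xs) (u m k - us m) - 2 * B m)
    <= V xs us k by rewrite sumE /V /energy gerDl oppr_le0 mulr_ge0.
case: K_le_or_F0 => [Km|F0].
  apply: le_trans VB; rewrite mulr_sumr -big_split; apply: ler_sum => m _ /=.
  rewrite mulrCA -mulrDr ler_pM2l//.
  rewrite -(subBB (xR k.+1) (xR k) xs) -(subBB (u m k.+1) (u m k) (us m)).
  apply: (@block_energy_forward _ _ _ _ _ _ (LF m)) => //.
    rewrite subBB (_ : _ - _ *: _ = x m k.+1 - xs); last first.
      by rewrite (block_update m k) addrAC.
    exact: gradient_cocoercive.
  exact: dual_monotone.
have rDV : rho * DV k <= DV k.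
  rewrite ler_piMl// (le_trans (rho_le (Ordinal M0)))// gerDl oppr_le0.
  by rewrite divr_ge0// mulr_ge0// ltW.
apply: le_trans (lerD (lexx _) rDV) _; apply: le_trans VB.
rewrite -big_split; apply: ler_sum => m _ /=; rewrite -mulrDr ler_pM2l//.
have dg0 : gradient (F m) (x m k.+1) - gradient (F m) xs = 0.
  by rewrite !gradient_cst0 ?subrr.
rewrite (block_energy_step _ _ _ (xR k - xs) _ (u m k - us m) _ 0) !subBB.
rewrite dotp0l mulr0 subr0 /B /primal_residual dg0 subBB.
have := dual_monotone m k sad; rewrite subBB.
move/(mulr_ge0 (mulr_ge0 (ler0n R 2) (ltW (c0 m)))).
lra.
Qed.

Let dual_bound xs us k m : saddle K F H Rg xs us ->
  w m * ((c m * eta) ^+ 2 * `|u m k.+1 - us m| ^+ 2) <= 2 * eta * V xs us k.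
Proof.
move=> sad.
have := energy_block_le c w0 w1 K_le m (xR k - xs) (fun m => u m k - us m).
apply: le_trans.
by rewrite ler_pM2l//; apply: dual_step_le => //; exact: dual_monotone.
Qed.

Let dual_increment_bound k m :
  w m * ((c m * eta) ^+ 2 * `|u m k.+2 - u m k.+1| ^+ 2) <= 2 * eta * DV k.
Proof.
have := energy_block_le c w0 w1 K_le m (xR k.+1 - xR k)
  (fun m => u m k.+1 - u m k).
apply: le_trans.
by rewrite ler_pM2l//; apply: dual_step_le => //; exact: dual_increment_monotone.
Qed.

Let dual_step_cvg m (f : nat -> U m) (e : nat -> R) :
  (forall k, w m * ((c m * eta) ^+ 2 * `|f k| ^+ 2) <= 2 * eta * e k) ->
  e @ \oo --> 0 -> f @ \oo --> 0.
Proof.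
move=> fe e0; apply: cvg_sqr_norm0.
pose C := w m * (c m * eta) ^+ 2.
have C0 : 0 < C by rewrite mulr_gt0// exprn_gt0// mulr_gt0.
apply: (@squeeze_cvgr _ _ _ _ (fun=> 0) (fun k => C^-1 * (2 * eta) * e k)).
- near=> k; rewrite exprn_ge0//= -mulrA ler_pdivlMl// -mulrA; exact: fe.
- exact: cvg_cst.
- rewrite -[0](mulr0 (C^-1 * (2 * eta))); apply: cvgM => //; exact: cvg_cst.
Unshelve. all: by end_near.
Qed.

Let primal_cvg (d : nat -> X) (e : nat -> R) :
  (forall k, `|d k| ^+ 2 <= 2 * e k.+1 + 4 * M%:R * e k) ->
  e @ \oo --> 0 -> d @ \oo --> 0.
Proof.
move=> de e0; apply: cvg_sqr_norm0.
apply: (@squeeze_cvgr _ _ _ _ (fun=> 0) (fun k => 2 * e k.+1 + 4 * M%:R * e k)).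
- by near=> k; rewrite exprn_ge0//=.
- exact: cvg_cst.
- rewrite -[0](addr0 0) -{1}[0](mulr0 2) -[X in _ + X](mulr0 (4 * M%:R)).
  apply: cvgD; apply: cvgM => //; try exact: cvg_cst.
  by rewrite (cvg_shiftS e).
Unshelve. all: by end_near.
Qed.

Let block_cvg (FF : set_system nat) {FFF : Filter FF} m (l : X) :
  xR @ FF --> l -> (fun k => u m k.+1 - u m k) @ FF --> 0 ->
  (fun k => x m k.+1) @ FF --> l.
Proof.
move=> xl du; under eq_fun do rewrite block_update.
rewrite -[l]subr0 -(scaler0 _ (c m)) -(adjoint0 (K m)).
by apply: cvgB => //; apply: cvgZ; [exact: cvg_cst|apply: adjoint_cvg; exact: du].
Qed.

Let energy_nonincreasing xs us : saddle K F H Rg xs us ->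
  nonincreasing_seq (V xs us).
Proof.
move=> sad; apply/nonincreasing_seqP => k; apply: le_trans (energy_descent k sad).
by rewrite lerDl mulr_ge0// ltW.
Qed.

Let energy_is_cvg xs us : saddle K F H Rg xs us -> cvgn (V xs us).
Proof.
move=> sad; apply: nonincreasing_is_cvgn; first exact: energy_nonincreasing.
by exists 0 => _ [k _ <-].
Qed.

Let increment_cvg0 xs us : saddle K F H Rg xs us -> DV @ \oo --> 0.
Proof.
move=> sad; have cv := energy_is_cvg sad.
apply: (@squeeze_cvgr _ _ _ _ (fun=> 0)
  (fun k => rho^-1 * (V xs us k - V xs us k.+1))).
- near=> k; rewrite DV_ge0/= ler_pdivlMl// lerBrDl; exact: energy_descent.
- exact: cvg_cst.
- rewrite -[0](mulr0 rho^-1) -(subrr (limn (V xs us))).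
  apply: cvgM; [exact: cvg_cst|apply: cvgB => //].
  by rewrite (cvg_shiftS (V xs us)).
Unshelve. all: by end_near.
Qed.

Let dual_increment_cvg0 xs us m : saddle K F H Rg xs us ->
  (fun k => u m k.+1 - u m k) @ \oo --> 0.
Proof.
move=> sad; rewrite -(cvg_shiftS (fun k => u m k.+1 - u m k)).
by apply: (dual_step_cvg _ (increment_cvg0 sad)) => k; exact: dual_increment_bound.
Qed.

Let primal_increment_cvg0 xs us : saddle K F H Rg xs us ->
  (fun k => xR k.+1 - xR k) @ \oo --> 0.
Proof.
move=> sad; rewrite -(cvg_shiftS (fun k => xR k.+1 - xR k)).
apply: (primal_cvg _ (increment_cvg0 sad)) => k.
apply: (primal_le_energies w0 w1 eta0 K_le) => m; exact: dual_increment_bound.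
Qed.

(** An energy controls the iterate that follows it, hence the shifted indices. *)
Let iterates_cvg_of_energy xs us : saddle K F H Rg xs us ->
  V xs us @ \oo --> 0 ->
  (forall m, u m @ \oo --> us m) /\ xR @ \oo --> xs.
Proof.
move=> sad V0; split=> [m|].
  rewrite -(cvg_shiftS (u m)); apply/subr_cvg0.
  by apply: (dual_step_cvg _ V0) => k; exact: dual_bound.
rewrite -(cvg_shiftS xR); apply/subr_cvg0.
apply: (primal_cvg _ V0) => k.
by apply: (primal_le_energies w0 w1 eta0 K_le) => m; exact: dual_bound.
Qed.

Let iterates_bounded xs us : saddle K F H Rg xs us ->
  (exists r, \forall k \near \oo, `|xR k| <= r) /\
  (forall m, exists r, \forall k \near \oo, `|u m k| <= r).
Proof.
move=> sad; have V0 k : V xs us k <= V xs us 0.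
  by apply: (energy_nonincreasing sad).
have norm_le (Y : finHilbertType R) (z zs : Y) (r : R) :
    `|z - zs| ^+ 2 <= r -> `|z| <= `|zs| + (1 + r).
  move=> zr; rewrite -[z in `|z|](subrK zs) addrC.
  apply: le_trans (ler_normD _ _) _; rewrite lerD2l.
  apply: le_trans (_ : _ <= 1 + `|z - zs| ^+ 2) _.
    by have := sqr_ge0 (`|z - zs| - 1); rewrite sqrrB1; nra.
  by rewrite lerD2l.
split=> [|m].
  exists (`|xs| + (1 + (2 * V xs us 0 + 4 * M%:R * V xs us 0))).
  near=> k; have /prednK <- : (0 < k)%N by near: k; exact: nbhs_infty_gt.
  apply: norm_le.
  apply: le_trans
    (_ : _ <= 2 * V xs us k.-1.+1 + 4 * M%:R * V xs us k.-1) _.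
    by apply: (primal_le_energies w0 w1 eta0 K_le) => m; exact: dual_bound.
  by apply: lerD; rewrite ler_wpM2l// mulr_ge0.
pose C := w m * (c m * eta) ^+ 2.
have C0 : 0 < C by rewrite mulr_gt0// exprn_gt0// mulr_gt0.
exists (`|us m| + (1 + C^-1 * (2 * eta * V xs us 0))).
near=> k; have /prednK <- : (0 < k)%N by near: k; exact: nbhs_infty_gt.
apply: norm_le; rewrite ler_pdivlMl// -mulrA.
apply: le_trans (_ : _ <= 2 * eta * V xs us k.-1) _.
  by rewrite /C -[leLHS]mulrA; exact: dual_bound.
by rewrite -mulrA ler_pM2l// ler_pM2l.
Unshelve. all: by end_near.
Qed.

(** A cluster point of the iterates solves the optimality system: increments
    vanish, and the inclusions pass to the limit. *)
Let saddle_of_cluster (UF : set_system nat) xs us xb ub : UltraFilter UF ->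
  \oo `<=` UF -> saddle K F H Rg xs us ->
  xR @ UF --> xb -> (forall m, u m @ UF --> ub m) -> saddle K F H Rg xb ub.
Proof.
move=> UUF sUF sad xRb uub.
have du m : (fun k => u m k.+1 - u m k) @ UF --> 0.
  by move=> A /(dual_increment_cvg0 (m := m) sad); exact: sUF.
have dx : (fun k => xR k.+1 - xR k) @ UF --> 0.
  by move=> A /(primal_increment_cvg0 sad); exact: sUF.
have step (Y : finHilbertType R) (f : nat -> Y) (l : Y) : f @ UF --> l ->
    (fun k => f k.+1 - f k) @ UF --> 0 -> (fun k => f k.+1) @ UF --> l.
  move=> fl df; rewrite -[l]add0r.
  have -> : (fun k => f k.+1) = (fun k => (f k.+1 - f k) + f k).
    by apply/funext => k; rewrite subrK.
  exact: cvgD.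
have u1 m := step _ _ _ (uub m) (du m); have x1 := step _ _ _ xRb dx.
have xm m : (fun k => x m k.+1) @ UF --> xb by exact: block_cvg.
split=> [m|].
  apply: (@subdiff_closed _ _ _ _ UF _
    (fun k => K m (xR k) - (c m * eta) *: (u m k.+1 - u m k))
    (fun k => u m k.+1)) => //.
    by near=> k; exact: dual_inclusion.
  rewrite -[K m xb]subr0 -(scaler0 _ (c m * eta)); apply: cvgB.
    exact: linear_cvg.
  by apply: cvgZ; [exact: cvg_cst|exact: du].
apply: (@subdiff_closed _ _ _ _ UF _ (fun k => xR k.+1) _ _ _ Rg_pcc _ x1).
  by near=> k; exact: primal_inclusion.
have -> : - (M%:R^-1 *: \sum_(m < M) (gradient (F m) xb + adjoint (K m) (ub m)))
  = gamma^-1 *: (\sum_(m < M) w m *: (xb - c m *: gradient (F m) xb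
     - c m *: adjoint (K m) (ub m)) - xb).
  have MV : M%:R^-1 = gamma^-1 * (gamma * M%:R^-1) by rewrite mulKf ?gt_eqF.
  rewrite MV -scalerA -scalerN; congr (_ *: _).
  rewrite -[X in _ - X]scale1r -[in X in _ - X]w1 scaler_suml scaler_sumr.
  rewrite -!sumrN -big_split; apply: eq_bigr => m _ /=; rewrite -(wcE m).
  by move: (gradient (F m) _) (adjoint (K m) _) => g p; vect.
apply: cvgZ; first exact: cvg_cst.
apply: cvgB => //; apply: cvg_big => [|m _]; first exact: add_continuous.
apply: cvgZ; first exact: cvg_cst.
apply: cvgB; [apply: cvgB => //|]; apply: cvgZ; try exact: cvg_cst.
  by apply: smooth_gradient_cvg (F_smooth m) _.
by apply: adjoint_cvg; exact: u1.
Unshelve. all: by end_near.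
Qed.

(** The energy relative to the cluster point converges, and its limit can be
    computed along the ultrafilter. *)
Theorem iterates_cvg : (exists xs us, saddle K F H Rg xs us) ->
  exists xs us, [/\ saddle K F H Rg xs us, xR @ \oo --> xs,
    forall m, x m @ \oo --> xs & forall m, u m @ \oo --> us m].
Proof.
move=> [xs [us sad]].
have [UF [UUF sUF]] := @ultraFilterLemma nat \oo _.
have [[r xr] ur] := iterates_bounded sad.
have [xb xRb] := bounded_ultra_cvg (sUF _ xr).
have ub_ex m : exists l : U m, u m @ UF --> l.
  by have [s us_] := ur m; exact: bounded_ultra_cvg (sUF _ us_).
pose ub m := projT1 (cid (ub_ex m)).
have uub m : u m @ UF --> ub m by exact: projT2 (cid (ub_ex m)).
have sadb := saddle_of_cluster UUF sUF sad xRb uub.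
have Vb : V xb ub @ \oo --> 0.
  have VU : V xb ub @ UF --> 0.
    apply: (@energy_cvg0 _ _ _ _ K w c eta nat UF _ (fun k => xR k - xb)
      (fun k m => u m k - ub m)) => [|m]; apply/subr_cvg0.
      exact: xRb.
    exact: uub.
  have VU' : V xb ub @ UF --> limn (V xb ub).
    by move=> A /(energy_is_cvg sadb); exact: sUF.
  have <- := cvg_unique (@Rhausdorff R) VU' VU.
  exact: energy_is_cvg.
have [ucv xcv] := iterates_cvg_of_energy sadb Vb.
exists xb, ub; split=> // m; rewrite -(cvg_shiftS (x m)).
by apply: block_cvg => //; exact: (dual_increment_cvg0 (m := m) sadb).
Qed.

End Convergence.

(** * Minimisers, and the algorithm with its proximal steps *)

(** The linear terms of the subgradient inequalities of all the summands cancel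
    at a primal-dual solution. *)
Lemma saddle_argmin (R : realType) (X : finHilbertType R) (M : nat)
    (U : 'I_M -> finHilbertType R) (K : forall m, {linear X -> U m})
    (F : 'I_M -> X -> R) (H : forall m, U m -> \bar R) (Rg : X -> \bar R) xs us :
  (forall m, convex_function [set: X] (F m)) ->
  (forall m z, differentiable (F m) z) ->
  saddle K F H Rg xs us -> argmin (Psi K F H Rg) xs.
Proof.
move=> Fc Fd [Hs Rs] y; rewrite /Psi.
pose l m := dotp (gradient (F m) xs + adjoint (K m) (us m)) (y - xs).
have Mi : 0 <= M%:R^-1 :> R by rewrite invr_ge0.
have Rs' := Rs y; move: Rs'; rewrite dotpNl dotpZl dotp_suml -/(l _) => Rs'.
have block m : (((F m xs)%:E + H m (K m xs)) + (l m)%:E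
    <= (F m y)%:E + H m (K m y))%E.
  have Fm := gradient_le y (Fc m) (Fd m xs).
  have := Hs m (K m y); rewrite -linearB -dotp_adjointl.
  rewrite /l dotpDl; set p := dotp (adjoint _ _) _ => Hm.
  rewrite EFinD addeACA -EFinD; apply: leeD; last exact: Hm.
  by rewrite lee_fin.
have sumb : (\sum_(m < M) ((F m xs)%:E + H m (K m xs)) + (\sum_(m < M) l m)%:E
    <= \sum_(m < M) ((F m y)%:E + H m (K m y)))%E.
  by rewrite -sumEFin -big_split /=; apply: lee_sum => m _; exact: block.
set A := (\sum_(m < M) ((F m xs)%:E + _))%E in sumb *.
set B := (\sum_(m < M) ((F m y)%:E + _))%E in sumb *.
have sumM : (M%:R^-1%:E * A + (M%:R^-1 * \sum_(m < M) l m)%:E <= M%:R^-1%:E * B)%E.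
  by rewrite EFinM -muleDr ?fin_num_adde_defl// lee_wpmul2l// lee_fin.
have := leeD sumM Rs'; rewrite mulr_sumr addeACA -EFinD -mulr_sumr subrr adde0.
by [].
Qed.

Theorem theorem9 (R : realType) (M : nat) (hM : (1 <= M)%N)
  (X : finHilbertType R) (U : 'I_M -> finHilbertType R)
  (K : forall m : 'I_M, {linear X -> U m})
  (F : 'I_M -> X -> R) (LF : 'I_M -> R)
  (H : forall m : 'I_M, U m -> \bar R) (Rg : X -> \bar R)
  (hRg : proper_closed_convex Rg)
  (hH : forall m : 'I_M, proper_closed_convex (H m))
  (hLF : forall m : 'I_M, 0 < LF m)
  (hFconvex : forall m : 'I_M, convex_function [set: X] (F m))
  (hFsmooth : forall m : 'I_M, smooth (LF m) (F m))
  (w : 'I_M -> R) (hw : forall m : 'I_M, 0 < w m)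
  (hw1 : \sum_(m < M) w m = 1)
  (hsol : exists x : X, zero_of_inclusion K F H Rg x)
  (gam : nat -> R) (eta : R) (heta : 0 < eta)
  (xR : nat -> X) (x p a : 'I_M -> nat -> X)
  (u : forall m : 'I_M, nat -> U m)
  (hrun : distributed_PDDY K F H Rg w gam eta xR x p a u)
  (gamma : R) (hgam : forall k : nat, gam k = gamma)
  (hgamma0 : 0 < gamma)
  (hgamma : gamma < 2 / \big[Num.max/0]_(m < M) (LF m / (M%:R * w m)))
  (hetaK : \big[Num.max/0]_(m < M) (opnorm (K m) ^+ 2) <= eta \/
    (forall (m : 'I_M) (z : X), F m z = 0) /\
    opnorm (fun z : X => \sum_(m < M) w m *: adjoint (K m) (K m z)) <= eta) :
  (exists2 xstar : X, argmin (Psi K F H Rg) xstar &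
     (forall m : 'I_M, x m @ \oo --> xstar) /\ (xR @ \oo --> xstar)) /\
  (forall m : 'I_M, exists ustar : U m, u m @ \oo --> ustar).
Proof.
have MR0 : 0 < M%:R :> R by rewrite ltr0n.
pose c m := gamma / (M%:R * w m).
have Mw0 m : 0 < M%:R * w m by rewrite mulr_gt0.
pose L := \big[Num.max/0]_(m < M) (LF m / (M%:R * w m)).
have L_ge m : LF m / (M%:R * w m) <= L by rewrite /L (le_bigmax_cond _ (fun m => _)).
have L0 : 0 < L by apply: lt_le_trans (L_ge (Ordinal hM)); rewrite divr_gt0.
pose rho := 1 - gamma * L / 2.
have rho0 : 0 < rho.
  by rewrite /rho subr_gt0 ltr_pdivrMr// mul1r -ltr_pdivlMr.
have rho_le m : rho <= 1 - c m * LF m / 2.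
  rewrite /rho lerD2l lerN2 ler_pM2r ?invr_gt0// /c mulrAC -mulrA ler_pM2l//.
have K_le_of_max : \big[Num.max/0]_(m < M) (opnorm (K m) ^+ 2) <= eta ->
    forall m z, `|K m z| ^+ 2 <= eta * `|z| ^+ 2.
  move=> me m z; apply: (@le_trans _ _ ((opnorm (K m) * `|z|) ^+ 2)).
    by rewrite lerXn2r ?nnegrE ?opnorm_bound// (le_trans _ (opnorm_bound _ _)).
  rewrite exprMn ler_wpM2r ?exprn_ge0//; apply: le_trans me.
  exact: (le_bigmax_cond _ (fun m => _)).
have K_le z : \sum_(m < M) w m * `|K m z| ^+ 2 <= eta * `|z| ^+ 2.
  case: hetaK => [/K_le_of_max Km|[_ Te]].
    rewrite -[leRHS]mul1r -hw1 mulr_suml; apply: ler_sum => m _.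
    by rewrite ler_pM2l.
  pose T (z : X) := \sum_(m < M) w m *: adjoint (K m) (K m z).
  have Tl : linear T.
    move=> t y y'; rewrite /T scaler_sumr -big_split; apply: eq_bigr => m _ /=.
    by rewrite linearP adjoint_is_linear scalerDr !scalerA mulrC.
  pose lT : {linear X -> X} := HB.pack T (GRing.isLinear.Build _ _ _ _ _ Tl).
  have -> : \sum_(m < M) w m * `|K m z| ^+ 2 = dotp z (T z).
    rewrite /T dotp_sumr; apply: eq_bigr => m _.
    by rewrite dotpZr dotp_adjoint sqr_norm_dotp.
  apply: le_trans (dotp_le_norm _ _) _; rewrite mulrC expr2 mulrA ler_wpM2r//.
  apply: le_trans (opnorm_bound lT z) _; rewrite ler_wpM2r//.
have pE m k : p m k = adjoint (K m) (u m k).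
  by case: k => [|k]; [exact: (PDDY_p0 hrun)|exact: (PDDY_p hrun)].
have [xs [us [sad xRcv xcv ucv]]] : exists xs us, [/\ saddle K F H Rg xs us,
    xR @ \oo --> xs, forall m, x m @ \oo --> xs & forall m, u m @ \oo --> us m].
  apply: (iterates_cvg (w := w) (gamma := gamma) (eta := eta) (rho := rho)
    (LF := LF)) => //.
  - by case: hetaK => [/K_le_of_max|[F0 _]]; [left|right].
  - move=> m k; have t0 : 0 < M%:R * w m / (gamma * eta).
      by rewrite divr_gt0// mulr_gt0.
    have := prox_conjugate_subdiff
      (u m k + (M%:R * w m / (gamma * eta)) *: K m (xR k)) (hH m) t0.
    have uE := PDDY_u hrun m k; rewrite hgam in uE; rewrite /= -uE.
    rewrite (_ : _ *: (_ - u m k.+1) =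
      K m (xR k) - (c m * eta) *: (u m k.+1 - u m k)) //.
    move: (K m _) (u m _) (u m _) => y v v'; apply: dotp_ext => h.
    by rewrite /c !dotpE; field; rewrite !gt_eqF.
  - by move=> m k; rewrite (PDDY_x hrun) hgam !pE adjointB.
  - move=> k; have := prox_subdiff (M%:R^-1 *: \sum_(m < M) a m k) hRg hgamma0.
    have xE := PDDY_xR hrun k; rewrite hgam in xE; rewrite /= -xE.
    rewrite (_ : M%:R^-1 *: _ = \sum_(m < M) w m *: (x m k.+1
      - c m *: gradient (F m) (x m k.+1) - c m *: adjoint (K m) (u m k.+1))) //.
    rewrite scaler_sumr; apply: eq_bigr => m _; rewrite (PDDY_a hrun) hgam pE.
    move: (x m _) (gradient _ _) (adjoint _ _) => y g q; apply: dotp_ext => h.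
    by rewrite /c !dotpE; field; rewrite !gt_eqF.
  - have [xs [us [r [Hs Rs e0]]]] := hsol; exists xs, us; split=> //.
    by rewrite (_ : - _ = r)//; apply/eqP; rewrite eq_sym -addr_eq0 addrC -e0.
split; last by move=> m; exists (us m).
exists xs => //; apply: saddle_argmin sad => // m z.
by case: (hFsmooth m).
Qed.
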